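(* Let $\mathbf{G}$ be a $\mathbf{Cat}$-group. Then $$MH_0(\mathbf{G})=\mathbb{Z}\quad\text{and}\quad MH_1(\mathbf{G})=\mathrm{Con}(\mathbf{G})_{\mathrm{ab}},$$ the abelianization of the group of connected components in $\mathbf{G}$.
   Context: A $\mathbf{Cat}$-group is a one-object category enriched in $(\mathbf{Cat},\times)$ (equivalently, a monoid object in $\mathbf{Cat}$, i.e. a strict monoidal small category) whose underlying ordinary category is a group. In other words, it is a group $G$ (the underlying group) whose set of elements is the set of objects of a small category, such that multiplication is a functor; inversion is not required to be a functor. For $g,h\in G$, write $\mathbf{G}(g,h)$ for the set of arrows $g\to h$ in this category. Let $\sim$ be the equivalence relation on $G$ generated by the preorder ''$g\le h$ if $\mathbf{G}(g,h)\ne\emptyset$''. This is a congruence on the group $G$, and the quotient group $G/{\sim}$ is the group of connected components $\mathrm{Con}(\mathbf{G})$. $MH_\bullet(\mathbf{G})$ denotes iterated magnitude homology with respect to the free abelian group functor $\Sigma:\mathbf{Set}\to\mathbf{Ab}$, defined as follows. For a small category $\mathbf{C}$, $MB^\Sigma(\mathbf{C})$ is the simplicial abelian group with $MB^\Sigma_n(\mathbf{C})=\bigoplus_{x_0,\dots,x_n}\Sigma\mathbf{C}(x_0,x_1)\otimes\cdots\otimes\Sigma\mathbf{C}(x_{n-1},x_n)$, i.e. the free simplicial abelian group on the nerve of $\mathbf{C}$. This is a strong symmetric monoidal functor $\mathbf{Cat}\to[\Delta^{\mathrm{op}},\mathbf{Ab}]$ (pointwise tensor product). For a $\mathbf{Cat}$-enriched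 category $\mathbf{X}$, the double magnitude nerve $MB^{MB^\Sigma}(\mathbf{X})$ is the bisimplicial abelian group whose $p$-th simplicial abelian group is $\bigoplus_{x_0,\dots,x_p}MB^\Sigma(\mathbf{X}(x_0,x_1))\otimes_{\mathrm{pw}}\cdots\otimes_{\mathrm{pw}}MB^\Sigma(\mathbf{X}(x_{p-1},x_p))$ (for $p=0$: a direct sum over objects of the constant simplicial group $\mathbb{Z}$), with inner faces in the $p$-direction induced by composition in $\mathbf{X}$, outer faces by the functors from $\mathbf{X}(x_0,x_1)$ and $\mathbf{X}(x_{p-1},x_p)$ to the terminal category, and degeneracies by inserting identities. $MH_\bullet(\mathbf{X})$ is the homology of the chain complex (alternating sums of faces) of the diagonal simplicial abelian group of $MB^{MB^\Sigma}(\mathbf{X})$. *)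

(* Defs.v *)
From Stdlib Require Import Relations.
From HB Require Import structures.
From mathcomp Require Import all_boot.
From mathcomp Require Import ssralg ssrint ring_quotient.
From mathcomp Require Import boolp.
From mathcomp Require Import freeg zify.

Set Implicit Arguments.
Unset Strict Implicit.
Unset Printing Implicit Defensive.

Import GRing.Theory.
Local Open Scope ring_scope.
Local Open Scope quotient_scope.
#[local] Obligation Tactic := idtac.

(* Composition is written in diagrammatic order. *)
Record category (O : Type) := Category {
  hom : O -> O -> Type;
  idc : forall x, hom x x;
  compc : forall x y z, hom x y -> hom y z -> hom x z;
  compc1l : forall x y (f : hom x y), compc (idc x) f = f;
  compc1r : forall x y (f : hom x y), compc f (idc y) = f;
  compcA : forall x y z t (f : hom x y) (g : hom y z) (h : hom z t),
    compc f (compc g h) = compc (compc f g) h }.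

Arguments idc {O} c x.
Arguments compc {O c x y z} f g.

(* An arrow bundled with its source and target: equality in this type compares
   arrows whose endpoints are equal but not convertible. *)
Definition arrow O (C : category O) := {xy : O * O & hom C xy.1 xy.2}.

Definition Arrow O (C : category O) x y (f : hom C x y) : arrow C :=
  existT (fun xy : O * O => hom C xy.1 xy.2) (x, y) f.

(* The functors whose action on objects is F. *)
Record functor_over O P (C : category O) (D : category P) (F : O -> P) :=
  FunctorOver {
  fhom : forall x y, hom C x y -> hom D (F x) (F y);
  fhom1 : forall x, fhom (idc C x) = idc D (F x);
  fhomM : forall x y z (f : hom C x y) (g : hom C y z),
    fhom (compc f g) = compc (fhom f) (fhom g) }.

Arguments fhom {O P C D F} f {x y} _ : rename.

Program Definition comp_functor O P Q (C : category O) (D : category P)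
    (E : category Q) (F : O -> P) (H : P -> Q) (f : functor_over C D F)
    (h : functor_over D E H) : functor_over C E (fun x => H (F x)) :=
  {| fhom := fun x y u => fhom h (fhom f u) |}.
Next Obligation. by move=> * /=; rewrite !fhom1. Qed.
Next Obligation. by move=> * /=; rewrite !fhomM. Qed.

Program Definition prod_cat O P (C : category O) (D : category P) :
    category (O * P) :=
  {| hom := fun a b => (hom C a.1 b.1 * hom D a.2 b.2)%type;
     idc := fun a => (idc C a.1, idc D a.2);
     compc := fun a b c f g => (compc f.1 g.1, compc f.2 g.2) |}.
Next Obligation. by move=> ? ? ? ? ? ? [f g] /=; rewrite !compc1l. Qed.
Next Obligation. by move=> ? ? ? ? ? ? [f g] /=; rewrite !compc1r. Qed.
Next Obligation. by move=> * /=; rewrite !compcA. Qed.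

Program Definition pair_functor O P Q (C : category O) (D : category P)
    (E : category Q) (F : O -> P) (H : O -> Q) (f : functor_over C D F)
    (h : functor_over C E H) :
    functor_over C (prod_cat D E) (fun x => (F x, H x)) :=
  {| fhom := fun x y u => (fhom f u, fhom h u) |}.
Next Obligation. by move=> * /=; rewrite !fhom1. Qed.
Next Obligation. by move=> * /=; rewrite !fhomM. Qed.

(* The poset [n] = {0 < ... < n} as a category. *)
Program Definition ord_cat n : category 'I_n.+1 :=
  {| hom := fun i j => (i <= j)%N : Prop;
     idc := fun i => leqnn i;
     compc := fun i j k => @leq_trans j i k |}.
Next Obligation. by move=> *; exact: eq_irrelevance. Qed.
Next Obligation. by move=> *; exact: eq_irrelevance. Qed.
Next Obligation. by move=> *; exact: eq_irrelevance. Qed.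

(* The n-simplices of the nerve of C are the functors [n] -> C. *)
Definition nerve O (C : category O) n : choiceType :=
  {classic {x : 'I_n.+1 -> O & functor_over (ord_cat n) C x}}.

Definition nerve_map O (C : category O) m n (F : 'I_m.+1 -> 'I_n.+1)
    (f : functor_over (ord_cat m) (ord_cat n) F) (s : nerve C n) : nerve C m :=
  existT _ (fun i => tag s (F i)) (comp_functor f (tagged s)).

Program Definition coface n (i : 'I_n.+2) :
    functor_over (ord_cat n) (ord_cat n.+1) (fintype.lift i) :=
  {| fhom := fun j k le_jk => _ |}.
Next Obligation. by move=> n i j k le_jk; rewrite /= leq_bump2. Qed.
Next Obligation. by move=> *; exact: eq_irrelevance. Qed.
Next Obligation. by move=> *; exact: eq_irrelevance. Qed.

Definition nerve_face O (C : category O) n (i : 'I_n.+2) :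
  nerve C n.+1 -> nerve C n := nerve_map (coface i).

Section TensorArrows.
Variables (M : monoidType) (C : category M).
Variable T : functor_over (prod_cat C C) C (fun a => (a.1 * a.2)%g).

Definition tens_hom x x' y y' (f : hom C x x') (g : hom C y y') :
    hom C (x * y)%g (x' * y')%g :=
  @fhom _ _ _ _ _ T (x, y) (x', y') (f, g).

End TensorArrows.

(* A one-object category enriched in Cat, i.e. a monoid object in Cat: M is the
   monoid of objects of its only hom-category. *)
Record cat_monoid (M : monoidType) := CatMonoid {
  mcat :> category M;
  mtens : functor_over (prod_cat mcat mcat) mcat (fun a => (a.1 * a.2)%g);
  mtensA : forall x x' y y' z z'
      (f : hom mcat x x') (g : hom mcat y y') (h : hom mcat z z'),
    Arrow (tens_hom mtens f (tens_hom mtens g h)) =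
    Arrow (tens_hom mtens (tens_hom mtens f g) h);
  mtens1l : forall x x' (f : hom mcat x x'),
    Arrow (tens_hom mtens (idc mcat 1%g) f) = Arrow f;
  mtens1r : forall x x' (f : hom mcat x x'),
    Arrow (tens_hom mtens f (idc mcat 1%g)) = Arrow f }.

(* No compatibility of inversion with the arrows is required. *)
Definition cat_group (G : groupType) := cat_monoid G.

Definition nerve_mul (M : monoidType) (X : cat_monoid M) n
    (s t : nerve X n) : nerve X n :=
  existT _ (fun i => tag s i * tag t i)%g
    (comp_functor (pair_functor (tagged s) (tagged t)) (mtens X)).

Section GeneratedSubgroup.
Variables (V : zmodType) (S : V -> Prop).

Definition gen_subgroup : pred V := fun x =>
  `[< forall H : zmodClosed V, (forall y, S y -> y \in H) -> x \in H >].

Lemma gen_subgroup_closed : zmod_closed gen_subgroup.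
Proof.
split; first by apply/asboolP => H _; exact: rpred0.
move=> x y /asboolP xS /asboolP yS; apply/asboolP => H SH.
by apply: rpredB; [exact: xS | exact: yS].
Qed.

HB.instance Definition _ :=
  GRing.isZmodClosed.Build V gen_subgroup gen_subgroup_closed.

Lemma mem_gen_subgroup x : S x -> x \in gen_subgroup.
Proof. by move=> Sx; apply/asboolP => H; apply. Qed.

End GeneratedSubgroup.

Section Kernel.
Variables (U V : zmodType) (f : {additive U -> V}).

Definition kernel : pred U := fun x => f x == 0.

Lemma kernel_closed : zmod_closed kernel.
Proof.
split; first by rewrite unfold_in raddf0.
by move=> x y; rewrite !unfold_in raddfB => /eqP-> /eqP->; rewrite subrr.
Qed.

HB.instance Definition _ := GRing.isZmodClosed.Build U kernel kernel_closed.

Definition kernel_group := {x : U | kernel x}.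
HB.instance Definition _ := Choice.on kernel_group.
HB.instance Definition _ := SubType.on kernel_group.
HB.instance Definition _ :=
  [SubChoice_isSubZmodule of kernel_group by <:].

End Kernel.

Section Homology.
Variables (U V W : zmodType) (f : {additive U -> V}) (g : {additive V -> W}).

Definition boundary : pred (kernel_group g) :=
  fun x => `[< exists y, f y = val x >].

Lemma boundary_closed : zmod_closed boundary.
Proof.
split; first by apply/asboolP; exists 0; rewrite !raddf0.
move=> x y /asboolP [u fu] /asboolP [v fv]; apply/asboolP; exists (u - v).
by rewrite !raddfB /= fu fv.
Qed.

HB.instance Definition _ :=
  GRing.isZmodClosed.Build (kernel_group g) boundary boundary_closed.

(* The homology ker g / im f at V of U --f--> V --g--> W, for g \o f = 0. *)
Definition homology : zmodType :=
  Quotient.quot (GRing.ZmodClosed.clone _ boundary _).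

End Homology.

Section FreeLift.
Variables (K : choiceType) (V : zmodType) (f : K -> V).

Definition flift : {freeg K} -> V := fglift (f : K -> zmodule V).

Lemma flift_additive : zmod_morphism flift.
Proof. exact: (@lift_is_additive int K (zmodule V) f). Qed.

HB.instance Definition _ :=
  GRing.isZmodMorphism.Build {freeg K} V flift flift_additive.

Lemma fliftZU k x : flift << k *g x >> = f x *~ k.
Proof. by rewrite /flift liftU. Qed.

Lemma fliftU x : flift << x >> = f x.
Proof. exact: fliftZU. Qed.

End FreeLift.

Section TensorPower.
Variables (p : nat) (A : zmodType).
Implicit Types (a : {ffun 'I_p -> A}) (i j : 'I_p) (x y : A).

Definition upd a i x : {ffun 'I_p -> A} :=
  [ffun j => if j == i then x else a j].

Definition multilinear (V : zmodType) (f : {ffun 'I_p -> A} -> V) :=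
  forall a i x y, f (upd a i (x + y)) = f (upd a i x) + f (upd a i y).

Variant tensor_relation : {freeg {ffun 'I_p -> A}} -> Prop :=
| TensorRelation a i x y : tensor_relation
    (<< upd a i (x + y) >> - (<< upd a i x >> + << upd a i y >>)).

(* The p-fold tensor power of A over the integers; for p = 0 there is no
   relation and it is infinite cyclic. *)
Definition tensor_power : zmodType :=
  Quotient.quot (GRing.ZmodClosed.clone _ (gen_subgroup tensor_relation) _).

Definition pure a : tensor_power := \pi << a >>.

Lemma pure_multilinear : multilinear pure.
Proof.
move=> a i x y; rewrite /pure -raddfD; apply/eqP.
rewrite -Quotient.idealrBE; apply: mem_gen_subgroup.
exact: TensorRelation.
Qed.

Section Lift.
Variables (V : zmodType) (f : {ffun 'I_p -> A} -> V).

(* The additive map sending pure a to f a, for f multilinear. *)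
Definition tensor_lift of multilinear f : tensor_power -> V :=
  fun t => flift f (repr t).

Hypothesis f_mul : multilinear f.

Lemma tensor_lift_pi D : tensor_lift f_mul (\pi D) = flift f D.
Proof.
suff : repr (\pi D : tensor_power) - D \in kernel (flift f).
  by rewrite unfold_in raddfB subr_eq0 => /eqP.
have : repr (\pi D : tensor_power) - D \in gen_subgroup tensor_relation.
  by rewrite [_ \in _]Quotient.idealrBE reprK.
move=> /asboolP; apply=> _ [a i x y].
by rewrite unfold_in raddfB raddfD /= !fliftU f_mul subrr.
Qed.

Lemma tensor_lift_pure a : tensor_lift f_mul (pure a) = f a.
Proof. by rewrite tensor_lift_pi fliftU. Qed.

Lemma tensor_lift_additive : zmod_morphism (tensor_lift f_mul).
Proof.
move=> s t; rewrite -[s]reprK -[t]reprK -raddfB !tensor_lift_pi.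
exact: raddfB.
Qed.

HB.instance Definition _ := GRing.isZmodMorphism.Build tensor_power V
  (tensor_lift f_mul) tensor_lift_additive.

End Lift.

End TensorPower.

Section TensorMap.
Variables (p : nat) (A B : zmodType) (f : {additive A -> B}).

Let pure_map (a : {ffun 'I_p -> A}) : tensor_power p B :=
  pure [ffun j => f (a j)].

Fact pure_map_multilinear : multilinear pure_map.
Proof.
move=> a i x y; have E z : [ffun j => f (upd a i z j)] =
    upd [ffun j => f (a j)] i (f z) :> {ffun 'I_p -> B}.
  by apply/ffunP => j; rewrite !ffunE; case: eqP.
by rewrite /pure_map !E raddfD pure_multilinear.
Qed.

Definition tensor_map : tensor_power p A -> tensor_power p B :=
  tensor_lift pure_map_multilinear.

HB.instance Definition _ := GRing.Additive.on tensor_map.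

Lemma tensor_map_pure a : tensor_map (pure a) = pure [ffun j => f (a j)].
Proof. exact: tensor_lift_pure. Qed.

End TensorMap.

Section MagnitudeNerve.
Variables (O : Type) (C : category O).

Definition MB n : zmodType := {freeg (nerve C n)}.

Definition MB_face n (i : 'I_n.+2) : MB n.+1 -> MB n :=
  flift (fun s => << nerve_face i s >>).

HB.instance Definition _ n i := GRing.Additive.on (@MB_face n i).

End MagnitudeNerve.

(* The map induced by the multiplication of X, under the identification of
   MB (C * D) with the pointwise tensor product of MB C and MB D. *)
Definition MB_mul (M : monoidType) (X : cat_monoid M) n (a b : MB X n) :
    MB X n :=
  flift (fun s => flift (fun t => << nerve_mul s t >>) b) a.

Lemma MB_mulDl (M : monoidType) (X : cat_monoid M) n (a b c : MB X n) :
  MB_mul (a + b) c = MB_mul a c + MB_mul b c.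
Proof. exact: raddfD. Qed.

Lemma MB_mulDr (M : monoidType) (X : cat_monoid M) n (a b c : MB X n) :
  MB_mul a (b + c) = MB_mul a b + MB_mul a c.
Proof.
rewrite /MB_mul -[a]freeg_sumE !raddf_sum -big_split; apply: eq_bigr => s _ /=.
by rewrite !fliftZU raddfD mulrzDl.
Qed.

Lemma MB_mulU (M : monoidType) (X : cat_monoid M) n (s t : nerve X n) :
  MB_mul << s >> << t >> = << nerve_mul s t >>.
Proof. by rewrite /MB_mul !fliftU. Qed.

Section DoubleMagnitudeNerve.
Variables (M : monoidType) (X : cat_monoid M).

(* As X has one object, the direct sum over tuples of objects has one summand. *)
Definition MB2 p q : zmodType := tensor_power p (MB X q).

Section HorizontalFace.
Variables (p q : nat) (i : 'I_p.+2).
Implicit Type a : {ffun 'I_p.+1 -> MB X q}.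

Definition drop_first a : {ffun 'I_p -> MB X q} :=
  [ffun j => a (fintype.lift ord0 j)].

Definition drop_last a : {ffun 'I_p -> MB X q} :=
  [ffun j => a (fintype.lift ord_max j)].

(* (a_0, ..., a_(i-1) * a_i, ..., a_p) for 0 < i <= p *)
Definition merge_at a : {ffun 'I_p -> MB X q} := [ffun j : 'I_p =>
  if (j.+1 < i)%N then a (fintype.lift ord_max j)
  else if j.+1 == i then
    MB_mul (a (fintype.lift ord_max j)) (a (fintype.lift ord0 j))
  else a (fintype.lift ord0 j)].

(* The outer faces are induced by functors to the terminal category, that is by
   the augmentation deg of MB X q. *)
Definition pure_face a : MB2 p q :=
  if i == ord0 then pure (drop_first a) *~ deg (a ord0)
  else if i == ord_max then pure (drop_last a) *~ deg (a ord_max)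
  else pure (merge_at a).

Fact pure_face_multilinear : multilinear pure_face.
Proof.
have update (F : MB X q -> {ffun 'I_p -> MB X q}) (g : MB X q -> MB X q) j x y :
    (forall z, F z = upd (F 0) j (g z)) -> {morph g : u v / u + v} ->
    pure (F (x + y)) = pure (F x) + pure (F y).
  by move=> FE gD; rewrite (FE (x + y)) (FE x) (FE y) gD pure_multilinear.
move=> a k x y; rewrite /pure_face.
case: eqP => [i0|/eqP i0].
  case: (unliftP ord0 k) => [k'|] ->.
    rewrite !ffunE /= -mulrzDl; congr (_ *~ _).
    apply: (update (fun z => drop_first (upd a _ z)) id k') => // z.
    by apply/ffunP => j; rewrite !ffunE (inj_eq lift_inj); case: eqP.
  rewrite !ffunE eqxx raddfD mulrzDr.
  by congr (pure _ *~ _ + pure _ *~ _); apply/ffunP => j; rewrite !ffunE.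
case: eqP => [im|/eqP im].
  case: (unliftP ord_max k) => [k'|] ->.
    rewrite !ffunE (negPf (neq_lift _ _)) -mulrzDl; congr (_ *~ _).
    apply: (update (fun z => drop_last (upd a _ z)) id k') => // z.
    by apply/ffunP => j; rewrite !ffunE (inj_eq lift_inj); case: eqP.
  rewrite !ffunE eqxx raddfD mulrzDr.
  congr (pure _ *~ _ + pure _ *~ _); apply/ffunP => j;
    by rewrite !ffunE eq_sym (negPf (neq_lift _ _)).
have i_gt0 : (0 < i)%N by rewrite lt0n.
have i_lep : (i <= p)%N.
  by rewrite -ltnS ltn_neqAle -ltnS ltn_ord andbT; apply: contra im => /eqP ?;
     apply/eqP/val_inj.
have p_gt0 : (0 < p)%N by exact: leq_trans i_lep.
have lt_kp : ((if k < i then k : nat else k.-1) < p)%N.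
  case: (ltnP k i) => [lt_ki|le_ik]; first exact: leq_trans i_lep.
  by rewrite prednK ?(leq_trans i_gt0) // -ltnS.
pose g z := if k.+1 == i then MB_mul z (a (inord k.+1))
  else if k == i :> nat then MB_mul (a (inord k.-1)) z else z.
apply: (update (fun z => merge_at (upd a k z)) g (Ordinal lt_kp)) => [z|u v].
  apply/ffunP => j; have lt_jp := ltn_ord j.
  have l0 : fintype.lift ord0 j = j.+1 :> nat by [].
  have lm : fintype.lift ord_max j = j :> nat by exact: lift_max.
  rewrite !ffunE -!val_eqE [val (fintype.lift ord_max j)]lm
    [val (fintype.lift ord0 j)]l0 /= /g.
  have -> : fintype.lift ord_max j = inord j :> 'I_p.+1.
    by apply/val_inj/(etrans lm)/esym/inordK; rewrite ltnS ltnW.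
  have -> : fintype.lift ord0 j = inord j.+1 :> 'I_p.+1.
    by apply/val_inj/(etrans l0)/esym/inordK.
  have -> : (j == (if (k < i)%N then k : nat else k.-1) :> nat) =
      if (k < i)%N then j == k :> nat else j.+1 == k :> nat.
    by case: (ltnP k i) => // le_ik; lia.
  case: (ltngtP j.+1 i) => [||] ji; case: (ltnP k i) => ki;
    do !(case: eqP => ?); try lia; try done.
    by congr (MB_mul _ (a (inord _))); lia.
  by congr (MB_mul (a (inord _)) _); lia.
rewrite /g; case: eqP => _; first exact: MB_mulDl.
by case: eqP => _ //; exact: MB_mulDr.
Qed.

Definition MB2_hface : MB2 p.+1 q -> MB2 p q :=
  tensor_lift pure_face_multilinear.

HB.instance Definition _ := GRing.Additive.on MB2_hface.

Lemma MB2_hface_pure a : MB2_hface (pure a) = pure_face a.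
Proof. exact: tensor_lift_pure. Qed.

End HorizontalFace.

Definition MB2_vface p q (i : 'I_q.+2) : MB2 p q.+1 -> MB2 p q :=
  tensor_map (@MB_face _ X q i).

HB.instance Definition _ p q i := GRing.Additive.on (@MB2_vface p q i).

(* Only the faces of the diagonal are needed for its chain complex. *)
Definition diag n : zmodType := MB2 n n.

Definition diag_face n (i : 'I_n.+2) : diag n.+1 -> diag n :=
  fun t => MB2_hface i (MB2_vface i t).

Definition diag_diff n (t : diag n.+1) : diag n :=
  \sum_(i < n.+2) diag_face i t *~ (-1) ^+ i.

Fact diag_diff_additive n : zmod_morphism (@diag_diff n).
Proof.
move=> s t; rewrite /diag_diff -sumrB; apply: eq_bigr => i _.
by rewrite /diag_face !raddfB mulrzBl.
Qed.

HB.instance Definition _ n :=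
  GRing.isZmodMorphism.Build (diag n.+1) (diag n) (@diag_diff n)
    (@diag_diff_additive n).

(* The differential out of degree n; it is null for n = 0. *)
Definition diag_out n : {additive diag n -> diag n.-1} :=
  if n is m.+1 then @diag_diff m else \0.

Definition MH n : zmodType := homology (@diag_diff n) (diag_out n).

End DoubleMagnitudeNerve.

Record congruence (G : groupType) := Congruence {
  congr_rel :> equiv_rel G;
  congrM : forall x x' y y', congr_rel x x' -> congr_rel y y' ->
    congr_rel (x * y)%g (x' * y')%g }.

Section QuotientGroup.
Variables (G : groupType) (c : congruence G).

Definition quotient_group := {eq_quot c}.
HB.instance Definition _ := Quotient.on quotient_group.
HB.instance Definition _ := Choice.on quotient_group.
HB.instance Definition _ : EqQuotient G c quotient_group :=
  EqQuotient.on quotient_group.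

Let q (x : G) : quotient_group := \pi x.

Definition qmul (u v : quotient_group) := q (repr u * repr v)%g.
Definition qinv (u : quotient_group) := q (repr u)^-1%g.

Let qW (P : quotient_group -> Prop) : (forall x, P (q x)) -> forall u, P u.
Proof. by move=> Pq u; rewrite -[u]reprK; exact: Pq. Qed.

Let q_eq x y : c x y -> q x = q y.
Proof. by move=> xy; apply/eqmodP. Qed.

Let repr_q x : c x (repr (q x)).
Proof. by apply/eqmodP; rewrite reprK. Qed.

Lemma qmul_pi x y : qmul (q x) (q y) = q (x * y)%g.
Proof. by apply/esym/q_eq/congrM; exact: repr_q. Qed.

Lemma qinv_pi x : qinv (q x) = q x^-1%g.
Proof.
apply: q_eq; have := congrM (congrM (equiv_refl c (repr (q x))^-1%g) (repr_q x))
  (equiv_refl c x^-1%g).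
by rewrite mulVg mul1g mulgK.
Qed.

Fact qmulA : associative qmul.
Proof.
by elim/qW=> x; elim/qW=> y; elim/qW=> z; rewrite !qmul_pi mulgA.
Qed.
Fact qmul1g : left_id (q 1%g) qmul.
Proof. by elim/qW=> x; rewrite qmul_pi mul1g. Qed.
Fact qmulg1 : right_id (q 1%g) qmul.
Proof. by elim/qW=> x; rewrite qmul_pi mulg1. Qed.
Fact qmulVg : left_inverse (q 1%g) qinv qmul.
Proof. by elim/qW=> x; rewrite qinv_pi qmul_pi mulVg. Qed.
Fact qmulgV : right_inverse (q 1%g) qinv qmul.
Proof. by elim/qW=> x; rewrite qinv_pi qmul_pi mulgV. Qed.

HB.instance Definition _ :=
  isGroup.Build quotient_group qmulA qmul1g qmulg1 qmulVg qmulgV.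

End QuotientGroup.

Section ConnectedComponents.
Variables (G : groupType) (X : cat_group G).

Definition hom_le (g h : G) : Prop := inhabited (hom X g h).

Definition connected : rel G :=
  fun g h => `[< clos_refl_sym_trans G hom_le g h >].

Fact connected_equiv : equiv_class_of connected.
Proof.
split=> [x|x y|y x z]; first by apply/asboolP/rst_refl.
  by apply/asboolP/asboolP; apply: rst_sym.
by move=> /asboolP xy /asboolP yz; exact/asboolP/(rst_trans _ _ _ _ _ xy yz).
Qed.

Fact connectedM x x' y y' :
  connected x x' -> connected y y' -> connected (x * y)%g (x' * y')%g.
Proof.
move=> /asboolP xx' /asboolP yy'; apply/asboolP.
apply: (@rst_trans _ _ _ (x' * y)%g).
  elim: xx' => {x x'} [x x' [f]|x|x x' _|x x1 x' _ IH _]; last 1 first.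
  - exact: rst_trans.
  - by apply: rst_step; split; exact: (tens_hom (mtens X) f (idc X y)).
  - exact: rst_refl.
  - exact: rst_sym.
elim: yy' => {y y'} [y y' [f]|y|y y' _|y y1 y' _ IH _]; last 1 first.
- exact: rst_trans.
- by apply: rst_step; split; exact: (tens_hom (mtens X) (idc X x') f).
- exact: rst_refl.
- exact: rst_sym.
Qed.

Definition Con : groupType :=
  quotient_group (@Congruence G (EquivRelPack connected_equiv) connectedM).

End ConnectedComponents.

Section Abelianization.
Variable G : groupType.

Definition derived_subgroup : pred G := fun z =>
  `[< forall H : groupClosed G, (forall x y, [~ x, y]%g \in H) -> z \in H >].

Lemma derived_subgroup_comm x y : derived_subgroup [~ x, y]%g.
Proof. by apply/asboolP => H; apply. Qed.

Lemma derived_subgroup1 : derived_subgroup 1%g.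
Proof. by apply/asboolP => H _; apply: gpred1. Qed.

Lemma derived_subgroupM x y :
  derived_subgroup x -> derived_subgroup y -> derived_subgroup (x * y)%g.
Proof.
move=> /asboolP xD /asboolP yD; apply/asboolP => H HD.
by apply: gpredM; [exact: xD | exact: yD].
Qed.

Lemma derived_subgroupV x : derived_subgroup x -> derived_subgroup (x^-1)%g.
Proof.
by move=> /asboolP xD; apply/asboolP => H HD; rewrite gpredV; exact: xD.
Qed.

Lemma derived_subgroupJ x y : derived_subgroup x -> derived_subgroup (x ^ y)%g.
Proof.
move=> xD; have -> : (x ^ y = x * [~ x, y])%g by rewrite commgEl mulVKg.
exact/derived_subgroupM/derived_subgroup_comm.
Qed.

Definition mod_derived : rel G := fun x y => derived_subgroup (x^-1 * y)%g.

Fact mod_derived_equiv : equiv_class_of mod_derived.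
Proof.
have sym x y : mod_derived x y -> mod_derived y x.
  by move=> /derived_subgroupV; rewrite /mod_derived invgM invgK.
split=> [x|x y|y x z]; first by rewrite /mod_derived mulVg derived_subgroup1.
  by apply/idP/idP => /sym.
rewrite /mod_derived => xy /(derived_subgroupM xy).
by rewrite mulgA mulgK.
Qed.

Fact mod_derivedM x x' y y' : mod_derived x x' -> mod_derived y y' ->
  mod_derived (x * y)%g (x' * y')%g.
Proof.
rewrite /mod_derived => /(derived_subgroupJ y) xD yD.
have := derived_subgroupM xD yD.
by rewrite conjgE invgM !mulgA mulgK.
Qed.

Definition abelianization : groupType :=
  quotient_group (@Congruence G (EquivRelPack mod_derived_equiv) mod_derivedM).

End Abelianization.

(* Main.v *)
Require Import Defs.
From Stdlib Require Import Relations.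
From HB Require Import structures.
From mathcomp Require Import all_boot.
From mathcomp Require Import ssralg ssrint ring_quotient.
From mathcomp Require Import boolp freeg zify.

Set Implicit Arguments.
Unset Strict Implicit.
Unset Printing Implicit Defensive.

Import GRing.Theory.
Local Open Scope ring_scope.
Local Open Scope quotient_scope.

(** In degree 0 the diagonal chain complex is the empty tensor power, which is
    infinite cyclic. Both faces out of degree 1 are the augmentation, so the first differential
    vanishes: degree 0 of the homology is infinite cyclic, and every chain of
    degree 1 is a cycle.

    In degree 1 the chains are the integral combinations of arrows of X, and the
    boundaries are spanned by
      d0 t - (d1 s)(d1 t) + d2 s,   for s, t two composable pairs of arrows,
    where d2, d1 and d0 give the first arrow, the composite and the second arrow
    of a pair, and where the product is the monoidal one ([diag_diff1U]).
    Sending an arrow to the component of its source, in the abelianized group of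
    components, kills these: faces do not change components, and the component
    of (d1 s)(d1 t) is the product of those of s and t
    ([diag1_component_diff]).

    Conversely, modulo boundaries:
    - an arrow f is equal to the identities of both its endpoints. To see this,
      keep s constant and let t be one of the two degenerate pairs with
      composite f, that is f preceded or followed by an identity. The two
      relations share their last two terms, so the terms d0 t agree: they are f
      and the identity of its target. Exchanging the roles of s and t gives the
      source ([edge_class_target], [edge_class_source]);
    - the class of an identity is additive in its object: take both pairs
      constant ([object_classM]).
    Thus every class is that of the identity of some object g, and the map from
    objects to classes is a homomorphism to an abelian group which is constant
    along arrows. It is trivial at any g whose component is trivial in the
    abelianization ([component_eq0]), so that the kernel of the component map
    consists of the boundaries ([diag1_component_eq0]). *)

(** * Quotients and induction principles for abelian groups *)

(** The first isomorphism theorem, in a form where cycles need not be handled as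
    elements of a subtype. *)
Lemma homology_iso (U V W K : zmodType) (f : {additive U -> V})
    (g : {additive V -> W}) (h : {additive V -> K}) :
    (forall v, g v = 0 -> (h v = 0 <-> exists u, f u = v)) ->
    (forall k, exists2 v, g v = 0 & h v = k) ->
  exists phi : {additive homology f g -> K}, bijective phi.
Proof.
move=> ker_h im_h.
have gker (z : kernel_group g) : g (val z) = 0 by apply/eqP; exact: (valP z).
have bdP z : (z \in @boundary U V W f g) = (h (val z) == 0).
  by apply/asboolP/eqP => /(ker_h _ (gker z)).
pose phi (x : homology f g) : K := h (val (repr x)).
have phi_pi z : phi (\pi z) = h (val z).
  apply/eqP; rewrite -subr_eq0 -!raddfB -bdP [_ \in _]Quotient.idealrBE.
  by rewrite reprK.
have phiB : zmod_morphism phi.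
  by move=> x y; rewrite -[x]reprK -[y]reprK -raddfB !phi_pi !raddfB.
pose phiA := GRing.isZmodMorphism.Build _ _ phi phiB.
pose Phi : {additive homology f g -> K} := HB.pack phi phiA.
exists Phi.
have pre k : exists x, phi x == k.
  have [v gv hv] := im_h k.
  have kv : kernel g v by apply/eqP.
  have e := phi_pi (exist _ v kv : kernel_group g); rewrite /= hv in e.
  by eexists; apply/eqP; exact: e.
exists (fun k => xchoose (pre k)) => [x|k]; last exact/eqP/(xchooseP (pre k)).
have /eqP := xchooseP (pre (phi x)); move: (xchoose _) => y.
rewrite -[x]reprK -[y]reprK !phi_pi => e.
apply/eqP; rewrite -Quotient.idealrBE [_ \in _]bdP.
by rewrite !raddfB e subrr.
Qed.

(** Equalities modulo the image of f become equalities in Q. *)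
Lemma cokernel_exists (U V : zmodType) (f : {additive U -> V}) :
  exists (Q : zmodType) (p : {additive V -> Q}),
    forall v, p v = 0 <-> exists u, f u = v.
Proof.
pose I : pred V := fun v => `[< exists u, f u = v >].
have I_closed : zmod_closed I.
  split; first by apply/asboolP; exists 0; rewrite raddf0.
  move=> x y /asboolP [u fu] /asboolP [v fv]; apply/asboolP; exists (u - v).
  by rewrite raddfB fu fv.
pose IB := GRing.isZmodClosed.Build V I I_closed.
pose IZ : zmodClosed V := HB.pack I IB.
exists (Quotient.quot IZ), (\pi_(Quotient.quot IZ)) => v; split=> [v0|fu].
  apply/asboolP; rewrite -[v]subr0 -/(I _).
  have : (v - 0) \in IZ by rewrite Quotient.idealrBE v0 raddf0.
  by [].
rewrite -(raddf0 (\pi_(Quotient.quot IZ))); apply/eqP.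
by rewrite -Quotient.idealrBE subr0; apply/asboolP.
Qed.

(** Additive equations between chains need only be checked on generators. *)
Lemma freeg_ind (K : choiceType) (P : {freeg K} -> Prop) :
    P 0 -> (forall x y, P x -> P y -> P (x - y)) -> (forall k, P << k >>) ->
  forall x, P x.
Proof.
move=> P0 PB PU x.
have PN y : P y -> P (- y) by move=> Py; rewrite -sub0r; exact: PB.
have PD y z : P y -> P z -> P (y + z).
  by move=> Py Pz; rewrite -[z]opprK; apply: PB => //; exact: PN.
have PMn y n : P y -> P (y *+ n).
  by move=> Py; elim: n => [|n IHn]; rewrite ?mulr0n // mulrS; exact: PD.
rewrite -[x]freeg_sumE; elim/big_ind: _ => // k _.
rewrite -[X in << X *g _ >>]intz -freegU_mulz.
case: (coeff k x) => n /=; first exact/PMn/PU.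
by rewrite NegzE mulrNz; exact/PN/PMn/PU.
Qed.

Lemma tensor_ind p (A : zmodType) (P : tensor_power p A -> Prop) :
    P 0 -> (forall x y, P x -> P y -> P (x - y)) -> (forall a, P (pure a)) ->
  forall x, P x.
Proof.
move=> P0 PB Pp x; rewrite -[x]reprK; move: (repr x).
apply: freeg_ind => [|y z Py Pz|a]; first by rewrite raddf0.
  by rewrite raddfB; exact: PB.
exact: Pp.
Qed.

(** * Tensor powers of exponent 0 and 1 *)

Section TensorZero.
Variable A : zmodType.

Fact cst1_multilinear : multilinear (fun _ : {ffun 'I_0 -> A} => 1 : int).
Proof. by move=> a []. Qed.

Definition tensor0_deg : tensor_power 0 A -> int :=
  tensor_lift cst1_multilinear.
HB.instance Definition _ := GRing.Additive.on tensor0_deg.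

Lemma pure0 (a b : {ffun 'I_0 -> A}) : pure a = pure b.
Proof. by congr pure; apply/ffunP => -[]. Qed.

Lemma tensor0_degK (a : {ffun 'I_0 -> A}) x : pure a *~ tensor0_deg x = x.
Proof.
elim/tensor_ind: x => [|x y Ex Ey|b]; first by rewrite raddf0 mulr0z.
  by rewrite raddfB mulrzBr Ex Ey.
by rewrite /tensor0_deg tensor_lift_pure mulr1z; exact: pure0.
Qed.

End TensorZero.

Section TensorOne.
Variable A : zmodType.

Definition pure1 (x : A) : tensor_power 1 A := pure [ffun=> x].

Lemma pureE1 (a : {ffun 'I_1 -> A}) : pure a = pure1 (a ord0).
Proof. by congr pure; apply/ffunP => i; rewrite ffunE ord1. Qed.

Fact pure1_additive : zmod_morphism pure1.
Proof.
have D : {morph pure1 : x y / x + y}.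
  move=> x y; pose a : {ffun 'I_1 -> A} := [ffun=> 0].
  have E z : upd a ord0 z = [ffun=> z].
    by apply/ffunP => i; rewrite !ffunE ord1 eqxx.
  by rewrite /pure1 -!E; exact: pure_multilinear.
by move=> x y; rewrite -[in RHS](subrK y x) [in RHS]D addrK.
Qed.
HB.instance Definition _ := GRing.isZmodMorphism.Build _ _ pure1 pure1_additive.

Section Lift.
Variables (V : zmodType) (f : {additive A -> V}).

Fact tensor1_multilinear : multilinear (fun a : {ffun 'I_1 -> A} => f (a ord0)).
Proof. by move=> a i x y; rewrite !ord1 !ffunE eqxx raddfD. Qed.

Definition tensor1_lift : tensor_power 1 A -> V :=
  tensor_lift tensor1_multilinear.
HB.instance Definition _ := GRing.Additive.on tensor1_lift.

Lemma tensor1_lift_pure1 x : tensor1_lift (pure1 x) = f x.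
Proof. by rewrite /tensor1_lift tensor_lift_pure ffunE. Qed.

End Lift.
End TensorOne.

(** * Simplices of the nerve *)

Lemma functor_over_eq (O P : Type) (C : category O) (D : category P)
    (F : O -> P) (f g : functor_over C D F) :
  (forall x y (u : hom C x y), fhom f u = fhom g u) -> f = g.
Proof.
case: f g => [f f1 fM] [g g1 gM] /= fg.
have {}fg : f = g.
  apply: functional_extensionality_dep => x.
  by apply: functional_extensionality_dep => y; exact: funext.
by case: _ / fg g1 gM => g1 gM; congr FunctorOver; exact: Prop_irrelevance.
Qed.

Section Nerve.
Variables (O : Type) (C : category O).

Definition vertex n (i : 'I_n.+1) (s : nerve C n) : O := tag s i.

Definition cst_functor n x : functor_over (ord_cat n) C (fun=> x).
Proof.
by exists (fun _ _ _ => idc C x) => // *; exact/esym/compc1l.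
Defined.

Definition cst_simplex n x : nerve C n := existT _ (fun=> x) (cst_functor n x).

Lemma nerve_face_cst n i x :
  nerve_face i (cst_simplex n.+1 x) = cst_simplex n x.
Proof. by congr existT; exact: functor_over_eq. Qed.

Lemma nerve_map_id n F (f : functor_over (ord_cat n) (ord_cat n) F)
  (s : nerve C n) : F =1 id -> nerve_map f s = s.
Proof.
move=> /funext FE; case: _ / (esym FE) f => f; case: s => x s.
congr existT; apply: functor_over_eq => i j u /=.
by congr (fhom s _); exact: eq_irrelevance.
Qed.

Lemma nerve_map_cst m n F (f : functor_over (ord_cat m) (ord_cat n) F) k
    (s : nerve C n) :
  (forall i, F i = k) -> nerve_map f s = cst_simplex m (vertex k s).
Proof.
move=> /(@funext _ _ _ (fun=> k)) FE; case: _ / (esym FE) f => f.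
congr existT; apply: functor_over_eq => i j u /=.
rewrite -(fhom1 (tagged s)); congr (fhom _ _); exact: eq_irrelevance.
Qed.

Lemma nerve_map_comp l m n F G (f : functor_over (ord_cat l) (ord_cat m) F)
    (g : functor_over (ord_cat m) (ord_cat n) G) (s : nerve C n) :
  nerve_map f (nerve_map g s) = nerve_map (comp_functor f g) s.
Proof. by congr existT; exact: functor_over_eq. Qed.

Definition mono_functor m n (F : 'I_m.+1 -> 'I_n.+1)
    (mF : forall i j : 'I_m.+1, (i <= j)%N -> (F i <= F j)%N) :
  functor_over (ord_cat m) (ord_cat n) F.
Proof. by exists mF => *; exact: eq_irrelevance. Defined.

Definition codegeneracy n (i : 'I_n.+1) (j : 'I_n.+2) : 'I_n.+1 :=
  inord (unbump i j).

Lemma codegeneracyE n (i : 'I_n.+1) j : codegeneracy i j = unbump i j :> nat.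
Proof.
rewrite inordK // /unbump; case: (ltnP i j) (ltn_ord i) (ltn_ord j); lia.
Qed.

Fact codegeneracy_mono n (i : 'I_n.+1) (j k : 'I_n.+2) :
  (j <= k)%N -> (codegeneracy i j <= codegeneracy i k)%N.
Proof. by rewrite !codegeneracyE /unbump; lia. Qed.

Definition nerve_degeneracy n (i : 'I_n.+1) : nerve C n -> nerve C n.+1 :=
  nerve_map (mono_functor (@codegeneracy_mono n i)).

(** The coface k followed by the codegeneracy i is the identity of [n]. *)
Lemma face_degeneracy n (i : 'I_n.+1) (k : 'I_n.+2) (s : nerve C n) :
  (k == i :> nat) || (k == i.+1 :> nat) ->
  nerve_face k (nerve_degeneracy i s) = s.
Proof.
move=> ki; rewrite /nerve_face nerve_map_comp; apply: nerve_map_id => j.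
apply: val_inj; rewrite /= codegeneracyE /= /unbump /bump; lia.
Qed.

Lemma first_face_degeneracy (s : nerve C 1) :
  nerve_face ord0 (nerve_degeneracy ord_max s) =
  cst_simplex 1 (vertex ord_max s).
Proof.
rewrite /nerve_face nerve_map_comp; apply: nerve_map_cst => j.
by apply: val_inj; rewrite /= codegeneracyE; case: j => -[|[]].
Qed.

Lemma last_face_degeneracy (s : nerve C 1) :
  nerve_face ord_max (nerve_degeneracy ord0 s) =
  cst_simplex 1 (vertex ord0 s).
Proof.
rewrite /nerve_face nerve_map_comp; apply: nerve_map_cst => j.
by apply: val_inj; rewrite /= codegeneracyE; case: j => -[|[]].
Qed.

(** Arrows are given by their type whereas 1-simplices are functors on [1]; this
    is the passage from the former to the latter. *)
Lemma arrow_simplex x y (f : hom C x y) :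
  exists s : nerve C 1, vertex ord0 s = x /\ vertex ord_max s = y.
Proof.
(* Indexing by nat rather than by 'I_2 lets the dependent match reduce. *)
pose F (i : nat) := if i is 0%N then x else y.
pose Ff (i j : nat) : (i <= j)%N -> hom C (F i) (F j) :=
  match i, j with
  | 0%N, 0%N => fun=> idc C x
  | 0%N, _.+1 => fun=> f
  | _.+1, 0%N => fun l => False_rect _ (Bool.diff_false_true l)
  | _.+1, _.+1 => fun=> idc C y
  end.
unshelve eexists (existT _ (fun i : 'I_2 => F i) _ : nerve C 1); last by [].
exists (fun (i j : 'I_2) (l : (i <= j)%N) => Ff i j l).
  by case=> -[|i] ?.
by move=> [[|i] ?] [[|j] ?] [[|k] ?] //= u v; rewrite ?compc1l ?compc1r.
Qed.

Lemma vertices_hom n (s : nerve C n) i :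
  inhabited (hom C (vertex ord0 s) (vertex i s)).
Proof.
by split; exact: (fhom (tagged s) (leq0n i : hom (ord_cat n) ord0 i)).
Qed.

End Nerve.

(** * The diagonal differential in low degrees *)

(** The tensor functor preserves identities. *)
Lemma nerve_mul_cst (M : monoidType) (X : cat_monoid M) n (x y : M) :
  nerve_mul (cst_simplex X n x) (cst_simplex X n y) = cst_simplex X n (x * y)%g.
Proof.
congr existT; apply: functor_over_eq => i j u /=.
exact: (fhom1 (mtens X) (x, y)).
Qed.

Lemma MB_faceU O (C : category O) n i (s : nerve C n.+1) :
  MB_face i << s >> = << nerve_face i s >>.
Proof. exact: fliftU. Qed.

Lemma deg_MB_face O (C : category O) n i (x : MB C n.+1) :
  deg (MB_face i x) = deg x.
Proof.
elim/freeg_ind: x => [|x y Ex Ey|s]; first by rewrite !raddf0.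
  by rewrite raddfB /= !degB Ex Ey.
by rewrite MB_faceU !degU.
Qed.

Section Diagonal.
Variables (M : monoidType) (X : cat_monoid M).

Lemma diag_face_pure n i (a : {ffun 'I_n.+1 -> MB X n.+1}) :
  diag_face i (pure a) = pure_face i [ffun j => MB_face i (a j)].
Proof. by rewrite /diag_face /MB2_vface tensor_map_pure MB2_hface_pure. Qed.

(** Both faces of a 1-chain are its augmentation, as faces of the nerve preserve
    augmentations. *)
Lemma diag_diff0 (t : diag X 1) : diag_diff t = 0.
Proof.
elim/tensor_ind: t => [|x y Ex Ey|a]; first exact: raddf0.
  by rewrite raddfB /= Ex Ey subrr.
rewrite /diag_diff big_ord_recl big_ord1 !diag_face_pure /pure_face /=.
rewrite !ffunE !deg_MB_face.
rewrite (pure0 (drop_last _) (drop_first [ffun j => MB_face ord0 (a j)])).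
rewrite expr0 expr1 [ord_max]ord1 mulr1z mulrNz mulr1z; exact: subrr.
Qed.

(** Here and below, [fintype.lift ord0 ord0] is 1, the middle face index. *)
Lemma diag_diff1 (a : {ffun 'I_2 -> MB X 2}) :
  diag_diff (pure a) =
    pure1 (MB_face ord0 (a ord_max)) *~ deg (a ord0)
  - pure1 (MB_mul (MB_face (fintype.lift ord0 ord0) (a ord0))
                  (MB_face (fintype.lift ord0 ord0) (a ord_max)))
  + pure1 (MB_face ord_max (a ord0)) *~ deg (a ord_max).
Proof.
rewrite /diag_diff !big_ord_recl big_ord0 !diag_face_pure /pure_face /=.
rewrite !pureE1 !ffunE !deg_MB_face.
have -> : fintype.lift ord0 (fintype.lift ord0 ord0) = ord_max :> 'I_3.
  exact: val_inj.
have -> : fintype.lift ord_max ord0 = ord0 :> 'I_2 by exact: val_inj.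
have -> : fintype.lift ord0 ord0 = ord_max :> 'I_2 by exact: val_inj.
by rewrite /= expr0 expr1 sqrrN expr1n !mulr1z mulrNz mulr1z addr0 addrA.
Qed.

Lemma diag_diff1U (s t : nerve X 2) :
  diag_diff (pure [ffun i => if i == ord0 then << s >> else << t >>]) =
    pure1 << nerve_face ord0 t >>
  - pure1 << nerve_mul (nerve_face (fintype.lift ord0 ord0) s)
                       (nerve_face (fintype.lift ord0 ord0) t) >>
  + pure1 << nerve_face ord_max s >>.
Proof. by rewrite diag_diff1 !ffunE /= !MB_faceU MB_mulU !degU !mulr1z. Qed.

End Diagonal.

(** * Quotient groups and the abelianization *)

Section QuotientGroupTheory.
Variables (G : groupType) (c : congruence G).

Definition qclass (x : G) : quotient_group c := \pi x.

Lemma qclassP x y : qclass x = qclass y <-> c x y.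
Proof. by split=> [/eqmodP|xy] //; apply/eqmodP. Qed.

Lemma qclassM x y : qclass (x * y)%g = (qclass x * qclass y)%g.
Proof. exact/esym/qmul_pi. Qed.

Lemma qclassK u : qclass (repr u) = u.
Proof. exact: reprK. Qed.

End QuotientGroupTheory.

Section AbelianizationZmodule.
Variable H : groupType.

(** The additive copy of the abelianization: its sum is the group law, so that
    additive maps into it are morphisms into the multiplicative group. *)
Definition ab_zmod := (abelianization H : Type).
Definition ab_class (x : H) : abelianization H := @qclass H _ x.

Lemma ab_classP x y : ab_class x = ab_class y <-> derived_subgroup (x^-1 * y)%g.
Proof. exact: qclassP. Qed.

Lemma ab_classM x y : ab_class (x * y)%g = (ab_class x * ab_class y)%g.
Proof. exact: qclassM. Qed.

Lemma ab_class_surj u : exists x, ab_class x = u.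
Proof. by exists (repr u); exact: qclassK. Qed.

Lemma abelianization_mulC (u v : abelianization H) : (u * v = v * u)%g.
Proof.
have [x <-] := ab_class_surj u; have [y <-] := ab_class_surj v.
rewrite -!ab_classM; apply/ab_classP.
have -> : ((x * y)^-1 * (y * x) = [~ y, x])%g.
  by rewrite commgEl conjgE invgM !mulgA.
exact: derived_subgroup_comm.
Qed.

HB.instance Definition _ := Choice.on ab_zmod.
HB.instance Definition _ := GRing.isZmodule.Build ab_zmod
  (@mulgA (abelianization H)) abelianization_mulC (@mul1g _) (@mulVg _).

Section AdditiveOnGroup.
Variables (V : zmodType) (phi : H -> V).
Hypothesis phiM : forall x y, phi (x * y)%g = phi x + phi y.

Lemma additive_on1 : phi 1%g = 0.
Proof. by apply: (addrI (phi 1%g)); rewrite -phiM mulg1 addr0. Qed.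

Lemma additive_onV x : phi x^-1%g = - phi x.
Proof.
by apply: (addrI (phi x)); rewrite -phiM mulgV additive_on1 subrr.
Qed.

(** The kernel of phi is a subgroup, and contains the commutators because V is
    commutative. *)
Lemma derived_subgroup_ker z : derived_subgroup z -> phi z = 0.
Proof.
move=> /asboolP zD.
pose K : {pred H} := fun x => phi x == 0.
have K1 : (1%g : H) \in K by apply/eqP/additive_on1.
have KM : mulg_closed K.
  by move=> x y /eqP x0 /eqP y0; apply/eqP; rewrite phiM x0 y0 addr0.
have KV : invg_closed K.
  by move=> x /eqP x0; apply/eqP; rewrite additive_onV x0 oppr0.
pose mulK := isMulClosed.Build H K KM.
pose mul1K := isMul1Closed.Build H K K1.
pose invK := isInvClosed.Build H K KV.
pose KG : groupClosed H := HB.pack K mulK mul1K invK.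
suff /eqP : z \in KG by [].
apply: zD => x y; apply/eqP.
by rewrite commgEl conjgE !phiM !additive_onV addrCA addKr addNr.
Qed.

End AdditiveOnGroup.

End AbelianizationZmodule.

(** * The component map on chains *)

Section Component.
Variables (G : groupType) (X : cat_group G).

Definition con_class (g : G) : Con X := @qclass G _ g.

Lemma con_classP g h : con_class g = con_class h <-> connected X g h.
Proof. exact: qclassP. Qed.

Definition component (g : G) : ab_zmod (Con X) := ab_class (con_class g).

Lemma componentM g h : component (g * h)%g = component g + component h.
Proof. by rewrite -[RHS]ab_classM -[in RHS]qclassM. Qed.

Lemma component_surj u : exists g, component g = u.
Proof.
have [c <-] := ab_class_surj u; exists (repr c).
by congr ab_class; exact: qclassK.
Qed.

Lemma component_hom g h : inhabited (hom X g h) -> component g = component h.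
Proof.
by move=> gh; congr ab_class; apply/con_classP/asboolP/rst_step.
Qed.

(** The universal property of the abelianized group of components, as an
    inclusion of kernels: phi is constant on connected components, so descends
    to the group of components, where it kills the derived subgroup. *)
Lemma component_eq0 (V : zmodType) (phi : G -> V) g :
    (forall x y, phi (x * y)%g = phi x + phi y) ->
    (forall x y, inhabited (hom X x y) -> phi x = phi y) ->
  component g = 0 -> phi g = 0.
Proof.
move=> phiM phi_hom g0.
have phi_conn x y : connected X x y -> phi x = phi y.
  by move=> /asboolP; elim=> {x y} [x y /phi_hom|||x y z _ -> _ ->].
pose psi (u : Con X) : V := phi (repr u).
have psi_class x : psi (con_class x) = phi x.
  by apply: phi_conn; apply/con_classP; exact: qclassK.
have psiM u v : psi (u * v)%g = psi u + psi v.
  have Eu : con_class (repr u) = u := qclassK u.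
  have Ev : con_class (repr v) = v := qclassK v.
  rewrite -{1}Eu -{1}Ev -[X in psi X]qclassM [LHS]psi_class.
  exact: phiM.
rewrite -psi_class; apply: (derived_subgroup_ker psiM).
have /ab_classP : ab_class 1%g = ab_class (con_class g) by exact/esym/g0.
by rewrite invg1 mul1g.
Qed.

Definition chain_component n : MB X n -> ab_zmod (Con X) :=
  flift (fun s => component (vertex ord0 s)).
HB.instance Definition _ n := GRing.Additive.on (@chain_component n).

Lemma chain_componentU n (s : nerve X n) :
  chain_component << s >> = component (vertex ord0 s).
Proof. exact: fliftU. Qed.

(** A face may change the vertex 0, but an arrow joins the old to the new. *)
Lemma chain_component_face n i (x : MB X n.+1) :
  chain_component (MB_face i x) = chain_component x.
Proof.
elim/freeg_ind: x => [|x y Ex Ey|s]; first by rewrite !raddf0.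
  by rewrite !raddfB /= Ex Ey.
rewrite MB_faceU !chain_componentU; apply/esym/component_hom.
exact: vertices_hom.
Qed.

(** On a pair of simplices this says that components multiply; the degrees come
    from extending that identity bilinearly. *)
Lemma chain_component_mul n (x y : MB X n) :
  chain_component (MB_mul x y) =
    chain_component x *~ deg y + chain_component y *~ deg x.
Proof.
have mulBl (a b c : MB X n) : MB_mul (a - b) c = MB_mul a c - MB_mul b c.
  exact: raddfB.
have mulBr (a b c : MB X n) : MB_mul a (b - c) = MB_mul a b - MB_mul a c.
  by apply: (addIr (MB_mul a c)); rewrite -MB_mulDr !subrK.
elim/freeg_ind: x => [|x x' Ex Ex'|s].
- by rewrite [MB_mul 0 y]raddf0 !raddf0 mul0rz addr0.
- by rewrite mulBl !raddfB /= Ex Ex' mulrzBl opprD addrACA.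
elim/freeg_ind: y => [|y y' Ey Ey'|t].
- have E : MB_mul << s >> 0 = 0 :> MB X n.
    by rewrite -[X in MB_mul _ X](subrr 0) mulBr subrr.
  by rewrite E !raddf0 mul0rz addr0.
- by rewrite mulBr !raddfB /= Ey Ey' mulrzBl opprD addrACA.
by rewrite MB_mulU !degU !chain_componentU !mulr1z -componentM.
Qed.

Definition diag1_component : diag X 1 -> ab_zmod (Con X) :=
  tensor1_lift (@chain_component 1).
HB.instance Definition _ := GRing.Additive.on diag1_component.

Lemma diag1_component_diff (t : diag X 2) : diag1_component (diag_diff t) = 0.
Proof.
elim/tensor_ind: t => [|x y Ex Ey|a]; first by rewrite !raddf0.
  by rewrite !raddfB /= Ex Ey subrr.
rewrite diag_diff1 !raddfD !raddfN !raddfMz /= /diag1_component.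
rewrite !tensor1_lift_pure1 /= chain_component_mul !chain_component_face.
by rewrite !deg_MB_face opprD addrA [_ - _ - _]addrAC subrr sub0r addNr.
Qed.

End Component.

(** * Chains of degree 1 modulo boundaries *)

Section DegreeOneClasses.
Variables (G : groupType) (X : cat_group G).

Section Cokernel.
Variables (Q : zmodType) (p : {additive diag X 1 -> Q}).
Hypothesis p_diff : forall t : diag X 2, p (diag_diff t) = 0.

(** The class of an arrow modulo boundaries, when p is the projection onto the
    cokernel of the differential. *)
Definition edge_class (s : nerve X 1) : Q := p (pure1 << s >>).
Definition object_class (g : G) : Q := edge_class (cst_simplex X 1 g).

Lemma edge_class_mul (s t : nerve X 2) :
  edge_class (nerve_mul (nerve_face (fintype.lift ord0 ord0) s)
                        (nerve_face (fintype.lift ord0 ord0) t)) =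
    edge_class (nerve_face ord0 t) + edge_class (nerve_face ord_max s).
Proof.
have := p_diff (pure [ffun i => if i == ord0 then << s >> else << t >>]).
rewrite diag_diff1U !raddfD !raddfN /= addrAC => /eqP.
by rewrite subr_eq0 eq_sym => /eqP.
Qed.

Lemma object_classM g h :
  object_class (g * h)%g = object_class g + object_class h.
Proof.
have := edge_class_mul (cst_simplex X 2 g) (cst_simplex X 2 h).
by rewrite !nerve_face_cst nerve_mul_cst addrC.
Qed.

(** Both degeneracies of s have s as middle face, and their faces of index 0 are
    s and the identity of its target. Hence the relations that they satisfy with
    a constant first factor differ only in these faces. *)
Lemma edge_class_target (s : nerve X 1) :
  edge_class s = object_class (vertex ord_max s).
Proof.
pose c := cst_simplex X 2 1%g.
have := edge_class_mul c (nerve_degeneracy ord0 s).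
have := edge_class_mul c (nerve_degeneracy ord_max s).
rewrite first_face_degeneracy !face_degeneracy // => ->.
by move/addIr.
Qed.

(** As for the target, with the degeneracies of s as first factor: now their
    faces of index 2 are compared. *)
Lemma edge_class_source (s : nerve X 1) :
  edge_class s = object_class (vertex ord0 s).
Proof.
pose c := cst_simplex X 2 1%g.
have := edge_class_mul (nerve_degeneracy ord_max s) c.
have := edge_class_mul (nerve_degeneracy ord0 s) c.
rewrite last_face_degeneracy !face_degeneracy // => ->.
by move/addrI.
Qed.

Lemma object_class_hom x y :
  inhabited (hom X x y) -> object_class x = object_class y.
Proof.
move=> [f]; have [s [<- <-]] := arrow_simplex f.
by rewrite -edge_class_source edge_class_target.
Qed.

(** The classes of identities form a subgroup, because the objects form a group,
    and contain the class of every arrow. *)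
Lemma object_class_surj (v : diag X 1) : exists g, p v = object_class g.
Proof.
have o1 := additive_on1 object_classM; have oV := additive_onV object_classM.
elim/tensor_ind: v => [|v w [g Eg] [h Eh]|a].
- by exists 1%g; rewrite o1 raddf0.
- by exists (g * h^-1)%g; rewrite raddfB Eg Eh object_classM oV.
rewrite pureE1; elim/freeg_ind: (a ord0) => [|x y [g Eg] [h Eh]|s].
- by exists 1%g; rewrite o1 !raddf0.
- by exists (g * h^-1)%g; rewrite !raddfB /= Eg Eh object_classM oV.
by exists (vertex ord0 s); exact: edge_class_source.
Qed.

End Cokernel.

Lemma diag1_component_edge (s : nerve X 1) :
  diag1_component (pure1 << s >>) = component X (vertex ord0 s).
Proof. by rewrite /diag1_component tensor1_lift_pure1 -chain_componentU. Qed.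

(** A chain with trivial component is, modulo boundaries, the identity of an
    object with the same component, to which [component_eq0] applies. *)
Lemma diag1_component_eq0 (v : diag X 1) :
  diag1_component v = 0 <-> exists t : diag X 2, diag_diff t = v.
Proof.
split=> [v0|[t <-]]; last exact: diag1_component_diff.
have [Q [p pP]] := cokernel_exists (@diag_diff G X 1).
have p_diff (t : diag X 2) : p (diag_diff t) = 0 by apply/pP; exists t.
have [g pv] := object_class_surj p_diff v.
pose ig := pure1 << cst_simplex X 1 g >> : diag X 1.
have [t Et] : exists t : diag X 2, diag_diff t = v - ig.
  by apply/pP; rewrite raddfB pv subrr.
apply/pP; rewrite pv.
apply: (component_eq0 (object_classM p_diff) (object_class_hom p_diff)).
rewrite -v0 -[v](subrK ig) raddfD -Et /= diag1_component_diff add0r.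
exact/esym/diag1_component_edge.
Qed.

End DegreeOneClasses.

Theorem theorem7p6 (G : groupType) (X : cat_group G) :
  (exists f : {additive MH X 0 -> int}, bijective f) /\
  (exists f : MH X 1 -> abelianization (Con X),
     bijective f /\ {morph f : x y / (x + y)%R >-> (x * y)%g}).
Proof.
split.
  pose h := @tensor0_deg (MB X 0) : {additive diag X 0 -> int}.
  pose one : diag X 0 := pure [ffun=> 0].
  apply: (homology_iso (h := h)) => [v _|k].
    split=> [v0|[u <-]]; last by rewrite /= diag_diff0 raddf0.
    exists 0; rewrite raddf0 -[v](tensor0_degK [ffun=> 0]).
    by rewrite [tensor0_deg v]v0 mulr0z.
  exists (one *~ k); rewrite // raddfMz /= /tensor0_deg tensor_lift_pure.
  exact: intz.
pose h := @diag1_component G X : {additive diag X 1 -> ab_zmod (Con X)}.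
have [||phi phi_bij] := homology_iso (f := @diag_diff G X 1)
    (g := diag_out X 1) (h := h).
- by move=> v _; exact: diag1_component_eq0.
- move=> u; have [g <-] := component_surj u.
  exists (pure1 << cst_simplex X 1 g >>); first exact: diag_diff0.
  exact: diag1_component_edge.
by exists phi; split=> // x y; exact: (raddfD phi x y).
Qed.
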